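(* Let $N=(S,A,T,I)$ be a finite PTI net and $m_1,m_2$ two markings of $N$. If $m_1\sim_p m_2$ (pti-place bisimilarity), then $m_1\sim_{cn} m_2$ (causal-net bisimilarity).
   Context: Multisets over a finite set $S$ are functions $m:S\to\mathbb{N}$; $\mathcal{M}(S)$ is their set, $\theta$ the empty multiset, $\subseteq$ pointwise order, $\oplus$ pointwise sum, $(m\ominus m')(s)=\max\{m(s)-m'(s),0\}$, $\mathit{dom}(m)=\{s\mid m(s)\ne0\}$; a place $s$ also denotes the singleton multiset. A finite PTI net is $N=(S,A,T,I)$ with finite places $S$, finite labels $A$, finite transitions $T\subseteq(\mathcal{M}(S)\setminus\{\theta\})\times A\times(\mathcal{M}(S)\setminus\{\theta\})$ and inhibiting relation $I\subseteq S\times T$. For $t=(m,\ell,m')$: ${}^\bullet t=m$, $l(t)=\ell$, $t^\bullet=m'$, ${}^\circ t=\{s\mid(s,t)\in I\}$. $t$ is enabled at $m$ if ${}^\bullet t\subseteq m$ and ${}^\circ t\cap\mathit{dom}(m)=\emptyset$, and then $m[t\rangle m'$ with $m'=(m\ominus{}^\bullet t)\oplus t^\bullet$. Pti-place bisimilarity: for $R\subseteq S\times S$, $R^\oplus$ is the least relation on $\mathcal{M}(S)$ with $(\theta,\theta)\in R^\oplus$ and $(s_1\oplus m_1,s_2\oplus m_2)\in R^\oplus$ whenever $(s_1,s_2)\in R$ and $(m_1,m_2)\in R^\oplus$. $R$ is a pti-place bisimulation if whenever $(m_1,m_2)\in R^\oplus$: (1) for every $t_1$ with $m_1[t_1\rangle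 m_1'$ there is $t_2$ with $m_2[t_2\rangle m_2'$ such that (a) $({}^\bullet t_1,{}^\bullet t_2)\in R^\oplus$, $(t_1^\bullet,t_2^\bullet)\in R^\oplus$, $l(t_1)=l(t_2)$, $(m_1\ominus{}^\bullet t_1,m_2\ominus{}^\bullet t_2)\in R^\oplus$, and (b) for all $(s,s')\in R$, $s\in{}^\circ t_1\iff s'\in{}^\circ t_2$; (2) symmetrically when $m_2$ moves first. $m_1\sim_p m_2$ iff some pti-place bisimulation $R$ has $(m_1,m_2)\in R^\oplus$. Causal nets: a causal P/T net is a finite marked net $C=(B,L,E,\mathsf{m}_0)$ (conditions $B$, events $E$, labels $L$, each event $e$ having a pre-set ${}^\bullet e$, label $\mathsf{l}(e)$ and post-set $e^\bullet$) with flow relation $\mathsf{F}=\{(b,e)\mid b\in{}^\bullet e\}\cup\{(e,b)\mid b\in e^\bullet\}$, such that $\mathsf{F}$ is acyclic; for each $b$, ${}^\bullet b=\{e\mid b\in e^\bullet\}$ and $b^\bullet=\{e\mid b\in{}^\bullet e\}$ have at most one element; $\mathsf{m}_0(b)=1$ if ${}^\bullet b=\emptyset$ and $0$ otherwise; all arcs have weight at most 1. $Min(C)=\mathsf{m}_0$, $Max(C)=\{b\mid b^\bullet=\emptyset\}$. A causal PTI net is $C=(B,L,E,Y^{be},Y^{af},\mathsf{m}_0)$ where $(B,L,E,\mathsf{m}_0)$ is a causal P/T net, $Y^{be},Y^{af}\subseteq B\times E$ (''before'' and ''after'' inhibitor arcs), if $(b,e)\in Y^{be}$ then $(e',b)\in\mathsf{F}$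 for some event $e'$, if $(b,e)\in Y^{af}$ then $(b,e')\in\mathsf{F}$ for some event $e'$, and $\mathsf{F}\cup\prec_{af}\cup\prec_{be}$ is acyclic, where $e\prec_{af}e'$ iff there is $b$ with $(b,e)\in\mathsf{F}$ and $(b,e')\in Y^{af}$, and $e\prec_{be}e'$ iff there is $b$ with $(e',b)\in\mathsf{F}$ and $(b,e)\in Y^{be}$. A folding of $C$ into the marked net $N(m_0)$ is a map $\rho:B\cup E\to S\cup T$ with $\rho(B)\subseteq S$, $\rho(E)\subseteq T$, $L=A$, $\mathsf{l}(e)=l(\rho(e))$, $m_0(s)=|\rho^{-1}(s)\cap\mathsf{m}_0|$, ${}^\bullet\rho(e)(s)=|\rho^{-1}(s)\cap{}^\bullet e|$ and $\rho(e)^\bullet(s)=|\rho^{-1}(s)\cap e^\bullet|$ for all $s,e$; moreover, if $(s,\rho(e))\in I$ then every $b$ with $\rho(b)=s$ satisfies $(b,e)\in Y^{be}\cup Y^{af}\cup\mathsf{F}^{-1}$, and if $(b,e)\in Y^{be}\cup Y^{af}$ then $(\rho(b),\rho(e))\in I$. A PTI process of $N(m_0)$ is a pair $(C,\rho)$ with $\rho$ such a folding. For PTI processes $(C_i,\rho_i)$, $C_i=(B_i,L,E_i,Y_i^{be},Y_i^{af},\mathsf{m}_0)$, of $N(m_0)$, $(C_1,\rho_1)\xrightarrow{e}(C_2,\rho_2)$ holds if ${}^\bullet e\subseteq Max(C_1)$, $E_2=E_1\cup\{e\}$, $B_2=B_1\cup e^\bullet$, $\rho_1\subseteq\rho_2$;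 and, defining $\mathcal{B}$ by $b\,\mathcal{B}\,e'$ iff $(\rho_2(b),\rho_2(e'))\in I$ for $b\in e^\bullet$, $e'\in E_1$, and $\mathcal{A}$ by $b\,\mathcal{A}\,e$ iff $(\rho_2(b),\rho_2(e))\in I$ for $b\in B_2$ with $b^\bullet\ne\emptyset$ (in $C_2$), one has $\{b\in B_2\mid b\,\mathcal{A}\,e\}\cap Max(C_1)=\emptyset$, $Y_2^{be}=Y_1^{be}\cup\mathcal{B}$ and $Y_2^{af}=Y_1^{af}\cup\mathcal{A}$. A causal-net bisimulation is a set $R$ of triples $(\rho_1,C,\rho_2)$ where, for $i=1,2$, $(C,\rho_i)$ is a PTI process of $N(m_{0i})$ for some marking $m_{0i}$, such that whenever $(\rho_1,C,\rho_2)\in R$: (i) for all $t_1,C',\rho_1'$ with $(C,\rho_1)\xrightarrow{e}(C',\rho_1')$ and $\rho_1'(e)=t_1$, there exist $t_2,\rho_2'$ with $(C,\rho_2)\xrightarrow{e}(C',\rho_2')$, $\rho_2'(e)=t_2$ and $(\rho_1',C',\rho_2')\in R$; (ii) symmetrically when $(C,\rho_2)$ moves. Markings $m_1,m_2$ are causal-net bisimilar, $m_1\sim_{cn}m_2$, if some causal-net bisimulation contains a triple $(\rho_1^0,C^0,\rho_2^0)$ where $C^0$ has no events and $\rho_i^0(Min(C^0))=\rho_i^0(Max(C^0))=m_i$ (as multisets) for $i=1,2$. *)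

(* Defs.v *)
From Stdlib Require Import Relation_Operators.
From mathcomp Require Import all_boot.
From mathcomp Require Import finmap multiset.

Set Implicit Arguments.
Unset Strict Implicit.
Unset Printing Implicit Defensive.

Local Open Scope fmap_scope.
Local Open Scope mset_scope.
Local Open Scope fset_scope.

Record ptinet (S A : finType) := PTINet {
  trans : {fset {mset S} * A * {mset S}};
  trans_proper :
    forall t, t \in trans -> t.1.1 != mset0 /\ t.2 != mset0;
  inhib : {set S * trans}
}.

Section PTINets.
Variables (S A : finType) (N : ptinet S A).

Definition pre (t : trans N) : {mset S} := (val t).1.1.
Definition lab (t : trans N) : A := (val t).1.2.
Definition post (t : trans N) : {mset S} := (val t).2.
Definition inhset (t : trans N) : {set S} := [set s | (s, t) \in inhib N].

Definition enabled (m : {mset S}) (t : trans N) : Prop :=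
  (pre t `<=` m)%mset /\ forall s, s \in inhset t -> s \notin finsupp m.

Definition fires (m : {mset S}) (t : trans N) (m' : {mset S}) : Prop :=
  enabled m t /\ m' = ((m `\` pre t) `+` post t)%mset.

End PTINets.

Inductive addclos (S : finType) (R : S -> S -> Prop) :
    {mset S} -> {mset S} -> Prop :=
  | addclos0 : addclos R mset0 mset0
  | addclosD s1 s2 m1 m2 :
      R s1 s2 -> addclos R m1 m2 ->
      addclos R ([mset s1] `+` m1)%mset ([mset s2] `+` m2)%mset.

Section PlaceBisim.
Variables (S A : finType) (N : ptinet S A).

Definition matching (R : S -> S -> Prop) (m1 m2 : {mset S})
    (t1 t2 : trans N) : Prop :=
  [/\ addclos R (pre t1) (pre t2),
      addclos R (post t1) (post t2),
      lab t1 = lab t2,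
      addclos R (m1 `\` pre t1)%mset (m2 `\` pre t2)%mset
    & forall s s', R s s' -> (s \in inhset t1 <-> s' \in inhset t2)].

Definition place_bisimulation (R : S -> S -> Prop) : Prop :=
  forall m1 m2, addclos R m1 m2 ->
    (forall t1 m1', fires m1 t1 m1' ->
       exists t2 m2', fires m2 t2 m2' /\ matching R m1 m2 t1 t2) /\
    (forall t2 m2', fires m2 t2 m2' ->
       exists t1 m1', fires m1 t1 m1' /\ matching R m1 m2 t1 t2).

Definition place_bisimilar (m1 m2 : {mset S}) : Prop :=
  exists R, place_bisimulation R /\ addclos R m1 m2.

End PlaceBisim.

(* Nets related by a step share conditions and events, so conditions are drawn
   from one fixed infinite universe.  As in any net, an event is the triple of
   its pre-set, its label and its post-set; pre-sets and post-sets are sets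
   because arcs have weight at most 1. *)
Notation cond := nat (only parsing).
Notation event L := ({fset cond} * L * {fset cond})%type (only parsing).

Definition epre (L : finType) (e : event L) : {fset cond} := e.1.1.
Definition elab (L : finType) (e : event L) : L := e.1.2.
Definition epost (L : finType) (e : event L) : {fset cond} := e.2.

(* The initial marking takes values in {0, 1}; it is given by its support. *)
Record cnet (L : finType) := CNet {
  conds : {fset cond};
  events : {fset event L};
  ybe : {fset cond * event L};
  yaf : {fset cond * event L};
  init : {fset cond}
}.

Definition acyclic (X : Type) (r : X -> X -> Prop) : Prop :=
  forall x, ~ clos_trans X r x x.

Section CausalNets.
Variables (L : finType) (C : cnet L).

Definition cpre (b : cond) : {fset event L} :=
  [fset e in events C | b \in epost e].
Definition cpost (b : cond) : {fset event L} :=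
  [fset e in events C | b \in epre e].

Definition flow (x y : cond + event L) : Prop :=
  match x, y with
  | inl b, inr e => e \in events C /\ b \in epre e
  | inr e, inl b => e \in events C /\ b \in epost e
  | _, _ => False
  end.

Definition minC : {fset cond} := init C.
Definition maxC : {fset cond} := [fset b in conds C | cpost b == fset0].

Definition causal_pt : Prop :=
  [/\ forall e, e \in events C ->
        [/\ epre e != fset0, epost e != fset0,
            epre e `<=` conds C & epost e `<=` conds C],
      acyclic flow,
      forall b, b \in conds C -> #|` cpre b| <= 1 /\ #|` cpost b| <= 1
    & init C = [fset b in conds C | cpre b == fset0]].

Definition prec_af (e e' : event L) : Prop :=
  exists b, flow (inl b) (inr e) /\ (b, e') \in yaf C.
Definition prec_be (e e' : event L) : Prop :=
  exists b, flow (inr e') (inl b) /\ (b, e) \in ybe C.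

Definition flow_prec (x y : cond + event L) : Prop :=
  flow x y \/
  match x, y with
  | inr e, inr e' => prec_af e e' \/ prec_be e e'
  | _, _ => False
  end.

Definition causal_pti : Prop :=
  [/\ causal_pt,
      forall b e, (b, e) \in ybe C `|` yaf C ->
        b \in conds C /\ e \in events C,
      forall b e, (b, e) \in ybe C -> exists e', flow (inr e') (inl b),
      forall b e, (b, e) \in yaf C -> exists e', flow (inl b) (inr e')
    & acyclic flow_prec].

End CausalNets.

(* A map on the disjoint union of conditions and events, given by its two
   restrictions; both are finite partial maps, so that maps of a net and of its
   extensions are comparable by graph inclusion. *)
Record fold_map (S A : finType) (N : ptinet S A) := FoldMap {
  fcond : {fmap cond -> S};
  fevent : {fmap event A -> trans N}
}.

Section Processes.
Variables (S A : finType) (N : ptinet S A).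
Implicit Types (C : cnet A) (rho : fold_map N).

Definition fiber_card rho (X : {fset cond}) (s : S) : nat :=
  #|` [fset b in X | (fcond rho).[? b] == Some s]|.

Definition inhibited rho (b : cond) (e : event A) : Prop :=
  exists s t, [/\ (fcond rho).[? b] = Some s, (fevent rho).[? e] = Some t
                & (s, t) \in inhib N].

Definition folding (m0 : {mset S}) C rho : Prop :=
  [/\ domf (fcond rho) = conds C /\ domf (fevent rho) = events C,
      forall s, m0 s = fiber_card rho (init C) s,
      forall e t, (fevent rho).[? e] = Some t ->
        [/\ elab e = lab t,
            forall s, pre t s = fiber_card rho (epre e) s
          & forall s, post t s = fiber_card rho (epost e) s],
      forall e t s, (fevent rho).[? e] = Some t -> (s, t) \in inhib N ->
        forall b, (fcond rho).[? b] = Some s ->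
          [\/ (b, e) \in ybe C, (b, e) \in yaf C | flow C (inr e) (inl b)]
    & forall b e, (b, e) \in ybe C `|` yaf C -> inhibited rho b e].

Definition process (m0 : {mset S}) C rho : Prop :=
  causal_pti C /\ folding m0 C rho.

Definition fold_sub rho1 rho2 : Prop :=
  (forall b s, (fcond rho1).[? b] = Some s -> (fcond rho2).[? b] = Some s) /\
  (forall e t, (fevent rho1).[? e] = Some t -> (fevent rho2).[? e] = Some t).

Definition new_be C1 (e : event A) rho2 (b : cond) (e' : event A) : Prop :=
  [/\ b \in epost e, e' \in events C1 & inhibited rho2 b e'].

Definition new_af C2 (e : event A) rho2 (b : cond) : Prop :=
  [/\ b \in conds C2, cpost C2 b != fset0 & inhibited rho2 b e].

Definition extends C1 rho1 (e : event A) C2 rho2 : Prop :=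
  [/\ epre e `<=` maxC C1,
      events C2 = e |` events C1,
      conds C2 = conds C1 `|` epost e,
      init C2 = init C1
    & fold_sub rho1 rho2] /\
  [/\ forall b, new_af C2 e rho2 b -> b \notin maxC C1,
      forall b e', (b, e') \in ybe C2 <->
        (b, e') \in ybe C1 \/ new_be C1 e rho2 b e'
    & forall b e', (b, e') \in yaf C2 <->
        (b, e') \in yaf C1 \/ (e' = e /\ new_af C2 e rho2 b)].

Definition pstep C1 rho1 (e : event A) C2 rho2 : Prop :=
  exists m0, [/\ process m0 C1 rho1, process m0 C2 rho2
               & extends C1 rho1 e C2 rho2].

Definition cn_bisimulation
    (R : fold_map N -> cnet A -> fold_map N -> Prop) : Prop :=
  forall rho1 C rho2, R rho1 C rho2 ->
    [/\ exists m01, process m01 C rho1,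
        exists m02, process m02 C rho2,
        forall e t1 C' rho1',
          pstep C rho1 e C' rho1' -> (fevent rho1').[? e] = Some t1 ->
          exists t2 rho2', [/\ pstep C rho2 e C' rho2',
            (fevent rho2').[? e] = Some t2 & R rho1' C' rho2']
      & forall e t2 C' rho2',
          pstep C rho2 e C' rho2' -> (fevent rho2').[? e] = Some t2 ->
          exists t1 rho1', [/\ pstep C rho1 e C' rho1',
            (fevent rho1').[? e] = Some t1 & R rho1' C' rho2']].

Definition marks rho (X : {fset cond}) (m : {mset S}) : Prop :=
  forall s, fiber_card rho X s = m s.

Definition cn_bisimilar (m1 m2 : {mset S}) : Prop :=
  exists R rho1 C rho2,
    [/\ cn_bisimulation R, R rho1 C rho2, events C = fset0,
        marks rho1 (minC C) m1 /\ marks rho1 (maxC C) m1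
      & marks rho2 (minC C) m2 /\ marks rho2 (maxC C) m2].

End Processes.

(* Main.v *)
Require Import Defs.
From mathcomp Require Import all_boot.
From mathcomp Require Import finmap multiset.

(** Given a pti-place bisimulation [R], take all triples [(rho1, C, rho2)] of
    processes over the same causal net such that [R] relates the two images of
    every condition, and the two images of every event are inhibited by
    [R]-related places simultaneously.  When [rho1] extends by an event [e]
    with image [t1], the transition [t1] is enabled at its own pre-set, which
    is [R]-related to [rho2 (epre e)]; [R] answers with some [t2] that must
    consume exactly [rho2 (epre e)], and the [R]-matching of the post-sets is
    transported to the new conditions.  The inhibitor arcs of the extended net
    depend only on which pairs (condition, event) are inhibited, and these are
    the same under both foldings. *)

Set Implicit Arguments.
Unset Strict Implicit.
Unset Printing Implicit Defensive.

Local Open Scope fmap_scope.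
Local Open Scope mset_scope.
Local Open Scope fset_scope.

(** * Images of finite sets of conditions and the additive closure *)

Section Fibers.
Variable S : finType.
Implicit Types (f g : nat -> option S) (X : {fset nat}) (m : {mset S}).
Implicit Types (R : S -> S -> Prop).

(** With [f] the lookup function of [fcond rho], this is [fiber_card rho X s]. A general [f] also
    covers images chosen before they belong to a folding. *)
Definition fibers f X (s : S) : nat := #|` [fset b in X | f b == Some s]|.

Definition related_on R f g X : Prop :=
  forall b, b \in X ->
    exists s1 s2, [/\ f b = Some s1, g b = Some s2 & R s1 s2].

Lemma eq_fibers f g X :
  {in X, f =1 g} -> fibers f X =1 fibers g X.
Proof.
move=> fg s; rewrite /fibers; congr #|` _|; apply/fsetP => b; rewrite !inE /=.
by case bX: (b \in X); rewrite //= fg.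
Qed.

Lemma fibers0 f s : fibers f fset0 s = 0.
Proof.
by apply/eqP; rewrite cardfs_eq0; apply/eqP/fsetP => b; rewrite !inE.
Qed.

Lemma fibersD1 f X b s :
  b \in X -> fibers f X s = ((f b == Some s) + fibers f (X `\ b) s)%N.
Proof.
move=> bX; rewrite /fibers (cardfsD1 b) !inE bX /=; congr (_ + #|` _|)%N.
by apply/fsetP => c; rewrite !inE andbA.
Qed.

Lemma fibers_gt0 f X s :
  0 < fibers f X s -> exists2 b, b \in X & f b = Some s.
Proof.
rewrite cardfs_gt0 => /fset0Pn[b]; rewrite !inE => /andP[bX /eqP fb].
by exists b.
Qed.

Lemma fibers_mem f X b s : b \in X -> f b = Some s -> 0 < fibers f X s.
Proof. by move=> bX fb; rewrite (fibersD1 _ _ bX) fb eqxx. Qed.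

Lemma fresh_nat X : exists b, b \notin X.
Proof.
exists (\max_(x <- X) x).+1; apply/negP => bX.
by have := @leq_bigmax_seq _ (enum_fset X) xpredT id _ bX isT; rewrite ltnn.
Qed.

(** Induction on [X]: each removed condition [b] contributes one pair of tokens, [f b] on the left
    and [g b] on the right. *)
Lemma addclos_fibers R f g X m1 :
  related_on R f g X -> m1 =1 fibers f X ->
  exists2 m2 : {mset S}, m2 =1 fibers g X & addclos R m1 m2.
Proof.
elim/finSet_rect: X m1 => X IH m1 rel fib1.
have [X0|/fset0Pn[b bX]] := eqVneq X fset0.
  exists mset0; first by move=> s; rewrite X0 fibers0 mset0E.
  have -> : m1 = mset0 by apply/msetP => s; rewrite fib1 X0 fibers0 mset0E.
  exact: addclos0.
have [s1 [s2 [fb gb Rs]]] := rel b bX.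
have [||m2 fib2 cl] := IH (X `\ b) (fproperD1 bX) (m1 `\ s1)%mset.
- by move=> c; rewrite !inE => /andP[_ /rel].
- move=> s; rewrite msetB1E fib1 (fibersD1 _ _ bX) fb eq_sym.
  by rewrite -[Some s == _]/(s == s1) addKn.
exists ([mset s2] `+` m2)%mset.
  move=> s; rewrite mset1DE fib2 (fibersD1 _ _ bX) gb.
  by rewrite -[Some s2 == _]/(s2 == s) eq_sym.
rewrite -(@msetB1K _ s1 m1); first exact: addclosD.
by rewrite in_mset fib1; exact: fibers_mem fb.
Qed.

(** Induction on the derivation of [addclos]: each pair [(s1, s2)] is charged to a condition of [X]
    that [f] sends to [s1], and [g] sends it to [s2]. *)
Lemma addclos_lift R f X m1 m2 :
  addclos R m1 m2 -> {in X, forall b, f b != None} -> m1 =1 fibers f X ->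
  exists g : {fmap nat -> S},
    [/\ domf g = X, m2 =1 fibers (fnd g) X & related_on R f (fnd g) X].
Proof.
move=> cl; elim: cl X => {m1 m2} [|s1 s2 m1 m2 Rs _ IH] X fX fib1.
  (* Fibers ignore conditions where [f] is undefined, so totality on [X] is what empties [X]
     here. *)
  have X0 : X = fset0.
    apply/eqP; apply: contraT => /fset0Pn[b bX]; move: (fX b bX).
    case fb: (f b) => [s|] // _.
    by have := fibers_mem bX fb; rewrite -fib1 mset0E.
  exists [fmap]; split; first by rewrite X0 domf0.
    by move=> s; rewrite X0 fibers0 mset0E.
  by move=> b; rewrite X0.
have [|b bX fb] := @fibers_gt0 f X s1; first by rewrite -fib1 mset1DE eqxx.
have [||g [dg fib2 rel]] := IH (X `\ b).
- by move=> c; rewrite !inE => /andP[_ /fX].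
- move=> s; have := fib1 s; rewrite mset1DE (fibersD1 _ _ bX) fb.
  by rewrite -[Some s1 == _]/(s1 == s) eq_sym => /addnI.
exists g.[b <- s2]; split.
- by rewrite dom_setf dg fsetD1K.
- move=> s; rewrite mset1DE fib2 (fibersD1 _ _ bX) fnd_set eqxx.
  rewrite -[Some s2 == _]/(s2 == s) eq_sym; congr (_ + _)%N.
  by apply: eq_fibers => c; rewrite !inE fnd_set => /andP[/negPf-> _].
- move=> c cX; rewrite fnd_set; case: eqVneq => [->|cb]; first by exists s1, s2.
  by apply: rel; rewrite !inE cb.
Qed.

(** One condition per token, by induction on the number of tokens. *)
Lemma mset_fibers m :
  exists X (f : {fmap nat -> S}), domf f = X /\ m =1 fibers (fnd f) X.
Proof.
have [n le_n] := ubnP (\sum_s m s); elim: n m le_n => // n IH m le_n.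
have [m0|/eqP m_neq0] := eqVneq m mset0.
  by exists fset0, [fmap]; split=> [|s]; rewrite ?domf0 // m0 mset0E fibers0.
have [s0 s0m|no] := pickP (fun s => s \in m); last first.
  case: m_neq0; apply/msetP => s.
  by rewrite mset0E; apply/mset_eq0P; rewrite no.
have [|X [f [df fibf]]] := IH (m `\ s0)%mset.
  rewrite -(msetB1K s0m) in le_n; move: le_n.
  under eq_bigr do rewrite mset1DE.
  by rewrite big_split /= (bigD1 s0) //= eqxx -addnA add1n ltnS;
    apply: leq_trans; rewrite ltnS leq_addl.
have [b bX] := fresh_nat X.
exists (b |` X), f.[b <- s0]; split=> [|s]; first by rewrite dom_setf df.
rewrite (fibersD1 _ _ (fset1U1 _ _)) fsetU1K //.
rewrite fnd_set eqxx -[Some s0 == _]/(s0 == s) -{1}(msetB1K s0m) mset1DE eq_sym.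
congr (_ + _)%N; rewrite fibf; apply: eq_fibers => c cX.
by rewrite fnd_set; case: eqVneq => // cb; rewrite -cb cX in bX.
Qed.

Lemma addclos_flip R m1 m2 :
  addclos R m1 m2 -> addclos (fun x y => R y x) m2 m1.
Proof. by elim=> *; [exact: addclos0|exact: addclosD]. Qed.

(** Each use of [addclosD] adds a token on the left. *)
Lemma addclos0l R m : addclos R mset0 m -> m = mset0.
Proof.
move En: mset0 => m0 cl; case: cl En => // s1 s2 m1 m2 _ _ E.
by have := mset1DE s1 m1 s1; rewrite -E mset0E eqxx.
Qed.

End Fibers.

(** Reduces moves of the second folding to moves of the first. *)
Lemma place_bisimulation_flip (S A : finType) (N : ptinet S A)
    (R : S -> S -> Prop) :
  place_bisimulation N R -> place_bisimulation N (fun x y => R y x).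
Proof.
move=> bis m1 m2 /addclos_flip/bis[fwd bwd].
have flip t1 t2 : matching R m2 m1 t2 t1 ->
    matching (fun x y => R y x) m1 m2 t1 t2.
  case=> cpre cpost cl crest inh; split=> //; try exact: addclos_flip.
  by move=> s s' /inh [].
split=> [t1 m1' /bwd|t2 m2' /fwd] [t [m [ft mt]]];
  by exists t, m; split=> //; exact: flip.
Qed.

(** * Linked foldings of one causal net *)

Section Steps.
Variables (S A : finType) (N : ptinet S A).
Implicit Types (R : S -> S -> Prop) (C : cnet A) (rho : fold_map N).

Definition inhib_match R (t1 t2 : trans N) : Prop :=
  forall s s', R s s' -> (s \in inhset t1 <-> s' \in inhset t2).

(** For events only inhibition is recorded: labels, pre-sets and post-sets are governed by the
    folding equations. *)
Definition linked R rho1 C rho2 : Prop :=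
  related_on R (fnd (fcond rho1)) (fnd (fcond rho2)) (conds C) /\
  forall e, e \in events C -> exists t1 t2,
    [/\ (fevent rho1).[? e] = Some t1, (fevent rho2).[? e] = Some t2
      & inhib_match R t1 t2].

Lemma linked_flip R rho1 C rho2 :
  linked R rho1 C rho2 -> linked (fun x y => R y x) rho2 C rho1.
Proof.
case=> relc rele; split=> [b /relc[s1 [s2 [f1 f2 Rs]]]|e].
  by exists s2, s1.
case/rele=> t1 [t2 [f1 f2 it]].
by exists t2, t1; split=> // s s' /it [].
Qed.

Lemma linked_inhibited R rho1 C rho2 b e :
  linked R rho1 C rho2 -> b \in conds C -> e \in events C ->
  inhibited rho1 b e <-> inhibited rho2 b e.
Proof.
case=> relc rele /relc[s1 [s2 [b1 b2 Rs]]] /rele[t1 [t2 [e1 e2 it]]].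
have := it _ _ Rs; rewrite !inE => -[fwd bwd].
split=> -[s [t []]]; rewrite ?b1 ?b2 ?e1 ?e2 => -[<-] [<-] i.
  by exists s2, t2; split=> //; exact: fwd.
by exists s1, t1; split=> //; exact: bwd.
Qed.

Lemma fnd_mem (K : choiceType) (V : Type) (f : {fmap K -> V}) k v :
  f.[? k] = Some v -> k \in domf f.
Proof. by move=> fk; rewrite -fndSome fk. Qed.

Lemma inhibited_mem C rho b e :
  domf (fcond rho) = conds C -> domf (fevent rho) = events C ->
  inhibited rho b e -> b \in conds C /\ e \in events C.
Proof.
move=> <- <- [s [t [bs et _]]].
by split; [exact: fnd_mem bs|exact: fnd_mem et].
Qed.

(** * Transporting an extension by one event to the other folding *)

Section Extension.
Variables (m01 : {mset S}) (C C' : cnet A) (rho1 rho1' : fold_map N).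
Variables (e : event A).
Hypotheses (proc1 : process m01 C rho1) (proc1' : process m01 C' rho1').
Hypothesis ext : extends C rho1 e C' rho1'.

Lemma extends_mem : e \in events C'.
Proof. by case: ext => -[_ -> _ _ _] _; rewrite fset1U1. Qed.

(** The pre-set of an event of [C] is nonempty, and its conditions are consumed in [C], hence not
    maximal. *)
Lemma extends_new : e \notin events C.
Proof.
case: proc1 => -[[evs _ _ _] _ _ _ _] _; case: ext => -[/fsubsetP mx _ _ _ _] _.
apply/negP => eC; have [/fset0Pn[b be] _ _ _] := evs _ eC.
have := mx _ be; rewrite !inE => /andP[_ /eqP/fsetP/(_ e)].
by rewrite !inE eC be.
Qed.

(** An old condition produced by [e] would have two producers in [C'], or be initial in [C], hence
    in [C'], despite having a producer there. *)
Lemma extends_post_new b : b \in epost e -> b \notin conds C.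
Proof.
move=> be; apply/negP => bC.
have [[[_ _ _ iC] _ _ _ _] _] := proc1.
have [[[_ _ single iC'] _ _ _ _] _] := proc1'.
have [[_ eC' cC' ini _] _] := ext.
have bC' : b \in conds C' by rewrite cC' inE bC.
have eb : e \in cpre C' b by rewrite !inE extends_mem be.
have [pb0|/fset0Pn[e0]] := eqVneq (cpre C b) fset0.
  have : b \in init C' by rewrite ini iC !inE bC /= pb0.
  by rewrite iC' !inE bC' /= => /eqP E; rewrite E in eb.
rewrite !inE => /andP[e0C be0]; have [le1 _] := single b bC'.
have e0b : e0 \in cpre C' b by rewrite !inE eC' !inE e0C be0 orbT.
have ne : e0 != e by apply: contraNneq extends_new => <-.
by move: le1; rewrite (cardfsD1 e) eb (cardfsD1 e0) in_fsetD1 ne e0b.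
Qed.

(* Otherwise the folding of [C'] would need an inhibitor arc between [b] and
   [e]: a before arc is excluded because [e] is new, an after arc because [b]
   is maximal. *)
Lemma extends_uninhibited b : b \in maxC C -> ~ inhibited rho1' b e.
Proof.
move=> bM; have := bM; rewrite !inE => /andP[bC _] [s [t [bs et i]]].
have [_ [_ _ _ /(_ e t s et i b bs) arc _]] := proc1'.
have [_ [naf ybeE yafE]] := ext.
have [[_ yC _ _ _] _] := proc1; have nC := extends_new.
case: arc => [/ybeE[y|[_ eC _]]|/yafE[y|[_ /naf]]|[_ be]].
- by have [|_ eC] := yC b e; [rewrite inE y|rewrite eC in nC].
- by rewrite eC in nC.
- by have [|_ eC] := yC b e; [rewrite inE y orbT|rewrite eC in nC].
- by rewrite bM.
- by have := extends_post_new be; rewrite bC.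
Qed.

Variable t1 : trans N.
Hypothesis et1 : (fevent rho1').[? e] = Some t1.

(** Each place of [pre t1] is the image of a condition of [epre e], which is maximal in [C] and so
    does not inhibit [e]. *)
Lemma extends_enabled : enabled (pre t1) t1.
Proof.
split=> [|s si]; first exact: msubset_refl.
apply/negP; rewrite msuppE in_mset.
have [_ [_ _ /(_ e t1 et1)[_ -> _] _ _]] := proc1'.
case/fibers_gt0 => b be bs.
have [[/fsubsetP/(_ b be) bM _ _ _ _] _] := ext.
by apply: (extends_uninhibited bM); exists s, t1; rewrite inE in si.
Qed.

(* The bisimulation game is played on the pre-set of [t1] alone, not on the
   whole marking: the answer [t2] must then consume all of [rho2 (epre e)], so
   it can label the very same event [e]. *)
Lemma extends_linked R m02 rho2 :
  place_bisimulation N R -> process m02 C rho2 -> linked R rho1 C rho2 ->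
  exists t2 rho2',
    [/\ process m02 C' rho2', extends C rho2 e C' rho2',
        (fevent rho2').[? e] = Some t2 & linked R rho1' C' rho2'].
Proof.
move=> bis proc2 [relc rele].
have [caus1 [[dc1 de1] ini1 ev1 _ _]] := proc1.
have [caus1' [[dc1' de1'] ini1' ev1' inh1' arc1']] := proc1'.
have [caus2 [[dc2 de2] ini2 ev2 inh2 arc2]] := proc2.
have [[mx eC' cC' iC' [subc sube]] [naf ybeE yafE]] := ext.
have [lab1 pre1 post1] := ev1' e t1 et1.
have old1 b : b \in conds C -> (fcond rho1').[? b] = (fcond rho1).[? b].
  by move=> /relc[s1 [s2 [b1 _ _]]]; rewrite b1; exact: subc.
have preC : epre e `<=` conds C.
  by apply/fsubsetP => b /(fsubsetP mx); rewrite !inE => /andP[].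
(* [m2] is the image of [epre e] under [rho2]. *)
have [m2 m2E cl] : exists2 m2 : {mset S},
    m2 =1 fibers (fnd (fcond rho2)) (epre e) & addclos R (pre t1) m2.
  apply: (@addclos_fibers _ _ (fnd (fcond rho1'))) => // b be.
  by have bC := fsubsetP preC b be; rewrite old1 //; exact: relc.
have [fwd _] := bis _ _ cl.
have [t2 [m2' [[[sub2 _] _] [_ clpost lab12 clrest it]]]] :=
  fwd t1 _ (conj extends_enabled erefl).
(* [t1] leaves no residue of its own pre-set, so the related residue of [m2] after [t2] is empty
   too. *)
have pre2 : pre t2 = m2.
  move: clrest; have -> : (pre t1 `\` pre t1)%mset = mset0.
    by apply/eqP; rewrite msetB_eq0 msubset_refl.
  move/addclos0l/eqP; rewrite msetB_eq0 => sub2'.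
  by apply/eqP; rewrite eqEmsubset sub2 sub2'.
have [|g [dg post2 relg]] :=
    @addclos_lift _ _ (fnd (fcond rho1')) (epost e) _ _ clpost _ post1.
  move=> b be; have bC' : b \in domf (fcond rho1').
    by rewrite dc1' cC' inE be orbT.
  by rewrite (in_fnd bC').
(* [g] takes precedence in the catenation, but its domain [epost e] is disjoint from [conds C]. *)
pose rho2' := FoldMap (fcond rho2 + g) (fevent rho2).[e <- t2].
have dgE b : (b \in domf g) = (b \in epost e) by rewrite dg.
have old2 b : b \in conds C -> (fcond rho2').[? b] = (fcond rho2).[? b].
  move=> bC; rewrite fnd_cat dgE; case: ifP => // /extends_post_new.
  by rewrite bC.
have new2 b : b \in epost e -> (fcond rho2').[? b] = g.[? b].
  by move=> be; rewrite fnd_cat dgE be.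
have olde e' : e' \in events C -> (fevent rho2').[? e'] = (fevent rho2).[? e'].
  move=> e'C; rewrite fnd_set; case: eqVneq => // ee.
  by have := extends_new; rewrite -ee e'C.
have newe : (fevent rho2').[? e] = Some t2 by rewrite fnd_set eqxx.
have lnk : linked R rho1' C' rho2'.
  split=> [b|e']; rewrite ?cC' ?eC' !inE.
    have [bC _|bC /= be] := boolP (b \in conds C).
      by rewrite old1 ?old2 //; exact: relc.
    by rewrite new2 //; exact: relg.
  case/orP => [/eqP->|e'C]; first by exists t1, t2.
  have [t [t' [f1 f2 itt]]] := rele e' e'C.
  by exists t, t'; split=> //; [exact: sube|rewrite olde].
have dc2' : domf (fcond rho2') = conds C' by rewrite domf_cat dc2 dg cC'.
have de2' : domf (fevent rho2') = events C' by rewrite dom_setf de2 eC'.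
(* This equivalence transfers every condition on inhibitor arcs below. *)
have inhE b e' : inhibited rho1' b e' <-> inhibited rho2' b e'.
  split=> i.
    have [bC eC] := inhibited_mem dc1' de1' i.
    exact/(linked_inhibited lnk bC eC).
  have [bC eC] := inhibited_mem dc2' de2' i.
  exact/(linked_inhibited lnk bC eC).
have fib2 X s : X `<=` conds C -> fiber_card rho2' X s = fiber_card rho2 X s.
  by move=> XC; apply: eq_fibers => b bX; exact/old2/(fsubsetP XC).
exists t2, rho2'; split=> //.
- split=> //; split=> //.
  + move=> s; rewrite iC' ini2 fib2 //; case: caus1 => -[_ _ _ ->] _ _ _ _.
    by apply/fsubsetP => b; rewrite !inE => /andP[].
  + move=> e' t; rewrite [X in X = _ -> _]fnd_set.
    case: eqVneq => [-> [<-]|ne e't].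
      split; first by rewrite lab1.
        by move=> s; rewrite fib2 // pre2 m2E.
      by move=> s; rewrite post2; apply: eq_fibers => b be; rewrite new2.
    have e'C : e' \in events C by rewrite -de2; exact: fnd_mem e't.
    have [l p q] := ev2 e' t e't.
    have [[evs _ _ _] _ _ _ _] := caus1; have [_ _ pc qc] := evs e' e'C.
    by split=> // s; rewrite fib2.
  (* The pair is also inhibited under [rho1'], whose folding supplies the required arc of [C']. *)
  + move=> e' t s e't i b bs.
    have /inhE[s1 [u [b1 e1 i1]]] : inhibited rho2' b e' by exists s, t.
    exact: inh1' e1 i1 b b1.
  + by move=> b e' /arc1' /inhE.
- split; first split=> //.
    split=> [b s bs|e' t e't].
      by rewrite old2 // -dc2; exact: fnd_mem bs.
    by rewrite olde // -de2; exact: fnd_mem e't.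
  split.
  + by move=> b [bC ne /inhE i]; apply: naf.
  + move=> b e'; rewrite ybeE; split=> -[y|[be e'C /inhE i]]; by [left|right].
  + move=> b e'; rewrite yafE; split=> -[y|[-> [bC ne /inhE i]]];
      by [left|right].
Qed.

End Extension.

(** * The causal-net bisimulation *)

Definition place_cn R rho1 C rho2 : Prop :=
  [/\ exists m, process m C rho1, exists m, process m C rho2
    & linked R rho1 C rho2].

Lemma place_cn_bisimulation R :
  place_bisimulation N R -> cn_bisimulation (place_cn R).
Proof.
move=> bis rho1 C rho2 [p1 p2 lnk]; split=> //.
- move=> e t1 C' rho1' [m [q q' ext]] et1; have [m2 q2] := p2.
  have [t2 [rho2' [q2' ext2 et2 lnk']]] :=
    extends_linked q q' ext et1 bis q2 lnk.
  exists t2, rho2'; split=> //; first by exists m2.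
  by split=> //; [exists m|exists m2].
- move=> e t2 C' rho2' [m [q q' ext]] et2; have [m1 q1] := p1.
  have [t1 [rho1' [q1' ext1 et1 lnk']]] :=
    extends_linked q q' ext et2 (place_bisimulation_flip bis) q1
      (linked_flip lnk).
  exists t1, rho1'; split=> //; first by exists m1.
  by split=> //; [exists m1|exists m|exact: linked_flip lnk'].
Qed.

(** * Event-free nets and the initial triple *)

Definition discrete_cnet (X : {fset nat}) : cnet A :=
  CNet X fset0 fset0 fset0 X.

Lemma discrete_max X : maxC (discrete_cnet X) = X.
Proof.
apply/fsetP => b; rewrite !inE /=; apply/andb_idr => _.
by apply/eqP/fsetP => e; rewrite !inE.
Qed.

Lemma discrete_causal X : causal_pti (discrete_cnet X).
Proof.
have nof x y : ~ flow (discrete_cnet X) x y by case: x y => [?|?] [?|?] // [].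
have noc (T : Type) (r : T -> T -> Prop) :
    (forall x y, ~ r x y) -> acyclic r.
  by move=> nor x; elim=> [? ? /nor|].
have cards (P : pred (event A)) : [fset e in @fset0 (event A) | P e] = fset0.
  by apply/fsetP => e; rewrite !inE.
split=> //.
- split=> //; first exact: noc.
    by move=> b _; rewrite /cpre /cpost !cards !cardfs0.
  by apply/fsetP => b; rewrite !inE /cpre cards eqxx andbT.
- by move=> b e; rewrite !inE.
- apply: noc => x y [/nof//|].
  by case: x y => [?|?] [?|?] // [] [b [/nof]].
Qed.

Lemma discrete_process X (f : {fmap nat -> S}) (m : {mset S}) :
  domf f = X -> m =1 fibers (fnd f) X ->
  process m (discrete_cnet X)
    (FoldMap f ([fmap] : {fmap event A -> trans N})).
Proof.
move=> df fib; split; first exact: discrete_causal.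
split=> //=.
- by move=> e t; rewrite fnd_fmap0.
- by move=> e t s; rewrite fnd_fmap0.
- by move=> b e; rewrite !inE.
Qed.

End Steps.

Theorem theorem27 (S A : finType) (N : ptinet S A) (m1 m2 : {mset S}%mset) :
  place_bisimilar N m1 m2 -> cn_bisimilar N m1 m2.
Proof.
case=> R [bis cl]; have [X [f1 [d1 fib1]]] := mset_fibers m1.
(* The same conditions [X] carry both markings, with [R]-related images. *)
have [|f2 [d2 fib2 rel]] := addclos_lift cl _ fib1.
  by move=> b; rewrite -d1 => bf; rewrite (in_fnd bf).
pose e0 : {fmap event A -> trans N} := [fmap].
exists (place_cn R), (FoldMap f1 e0), (discrete_cnet A X).
exists (FoldMap f2 e0).
rewrite /minC discrete_max.
split=> //; first exact: place_cn_bisimulation.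
- split; last by split.
  + by exists m1; exact: discrete_process.
  + by exists m2; exact: discrete_process.
- by split=> s; rewrite fib1.
- by split=> s; rewrite fib2.
Qed.
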